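(* Let $\beta>\alpha>0$, $\rho=\alpha/\beta<1$, let $L\ge1$ be an integer, and let $\rho\le\theta<1$. There exist $\gamma_\theta>0$ and $C_\theta<\infty$ such that, for every $u_0$ in $\mathcal V\cap L_2(g_\theta)$, the solution $u=(u_t)_{t\ge0}$ in $\mathcal V$ of $$\dot u_t(k)=\alpha\big(u_t(k-1)^L-u_t(k)^L\big)-\beta\big(u_t(k)-u_t(k+1)\big),\qquad k\ge1,$$ starting at $u_0$ satisfies $$\|u_t-\tilde u\|_{L_2(g_\theta)}\le\mathrm e^{-\gamma_\theta t}C_\theta\|u_0-\tilde u\|_{L_2(g_\theta)},\qquad t\ge0.$$
   Context: $\mathcal V=\{(v(k))_{k\in\mathbb N}:v(0)=1,\ v(k)\ge v(k+1),\ \lim_kv(k)=0\}$, $\mathbb N=\{0,1,\dots\}$. The differential equation has a unique $\mathcal V$-valued solution for each $u_0\in\mathcal V$ (known). $\tilde u(k)=\rho^{(L^k-1)/(L-1)}$ for $k\in\mathbb N$ (with $(L^k-1)/(L-1)$ read as $k$ when $L=1$); it is the unique stationary point of the equation in $\mathcal V$. $g_\theta=(\theta^k)_{k\ge1}$ and $L_2(g_\theta)=\{x\in\mathbb R^{\mathbb N}:x(0)=0,\ \|x\|^2_{L_2(g_\theta)}=\sum_{k\ge1}x(k)^2\theta^{-k}<\infty\}$; for $v\in\mathcal V$, ''$v\in\mathcal V\cap L_2(g_\theta)$'' means $\sum_{k\ge1}v(k)^2\theta^{-k}<\infty$ (the coordinate $k=0$ is disregarded). *)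

(* Defs.v *)
From Stdlib Require Import Reals Arith.
From Coquelicot Require Import Coquelicot.

Open Scope R_scope.

Definition in_V (v : nat -> R) : Prop :=
  v 0%nat = 1 /\ (forall k : nat, v (S k) <= v k) /\ is_lim_seq v 0.

(* Weights are indexed by k >= 1; the value [g theta 0] is never used. *)
Definition g (theta : R) (k : nat) : R := theta ^ k.

Definition L2_summable (w x : nat -> R) : Prop :=
  ex_series (fun k : nat => x (S k) ^ 2 / w (S k)).

Definition in_L2 (w x : nat -> R) : Prop :=
  x 0%nat = 0 /\ L2_summable w x.

(* Meaningful only under [L2_summable w x]: [Series] returns a default value
   on divergent series. *)
Definition L2_norm (w x : nat -> R) : R :=
  sqrt (Series (fun k : nat => x (S k) ^ 2 / w (S k))).

(* (L^k - 1) / (L - 1), read as k when L = 1; the division is exact in [nat]. *)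
Definition geom_exponent (L k : nat) : nat :=
  if Nat.eqb L 1 then k else Nat.div (L ^ k - 1) (L - 1).

Definition u_tilde (rho : R) (L k : nat) : R := rho ^ geom_exponent L k.

Definition ode_rhs (alpha beta : R) (L : nat) (v : nat -> R) (k : nat) : R :=
  alpha * (v (k - 1)%nat ^ L - v k ^ L) - beta * (v k - v (k + 1)%nat).

(* Only the values u t with t >= 0 matter: the derivative is taken relative to
   [0, +oo), hence it is two-sided for t > 0 and one-sided at t = 0. *)
Definition is_V_solution (alpha beta : R) (L : nat) (u0 : nat -> R)
    (u : R -> nat -> R) : Prop :=
  (forall k : nat, u 0 k = u0 k) /\
  (forall t : R, 0 <= t -> in_V (u t)) /\
  (forall (t : R) (k : nat), 0 <= t -> (1 <= k)%nat ->
     filterdiff (fun s : R => u s k)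
       (within (fun s : R => 0 <= s) (locally t))
       (fun h : R => scal h (ode_rhs alpha beta L (u t) k))).

(* Main.v *)
(** Let [y k = u k - u_tilde k]. Since [u k ^ L - u_tilde k ^ L = a k * y k] with
    [0 <= a k <= 1 + L * rho ^ k], the equation for [y] is that of a birth and death chain
    with birth rates [alpha * a k] and death rate [beta], killed at 0; in particular the tails
    [T k = |y k| + |y (k+1)| + ...] satisfy
    [T' k <= alpha * a (k-1) * |y (k-1)| - beta * |y k|], whatever the signs of the [y k].
    For weights [h k] comparable to [theta ^ (-k)] with
    [alpha * (1 + L * rho ^ k) * h (k+1) <= beta * h k], which exist because [rho <= theta],
    the energy [sum h k * T k ^ 2] then dissipates at least [2 * beta * sum h k * y k ^ 2], and
    by a Hardy inequality this controls the energy itself. The sums are truncated at a finite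
    rank [n]; the boundary term vanishes as [n] grows, uniformly on compact time intervals,
    because [u' k <= alpha * u (k-1)] propagates the decay of the initial value. *)
Require Import Defs.
From Stdlib Require Import Reals Lra Lia.
From Coquelicot Require Import Coquelicot.

Open Scope R_scope.

(** * Calculus of upper right Dini derivatives *)

(* The upper right Dini derivative of [f] at [t] is at most [d]; it replaces the derivative of
   absolute values, which need not exist. *)
Definition dini_le (f : R -> R) (t d : R) : Prop :=
  forall eps, 0 < eps -> exists delta, 0 < delta /\
    forall s, t < s < t + delta -> f s <= f t + (s - t) * (d + eps).

Lemma dini_le_weaken (f : R -> R) (t d d' : R) :
  d <= d' -> dini_le f t d -> dini_le f t d'.
Proof.
intros Hd Hf eps Heps; destruct (Hf eps Heps) as [delta [Hdelta H]].
exists delta; split; [easy|]; intros s Hs; specialize (H s Hs); nra.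
Qed.

Lemma dini_le_const (c t : R) : dini_le (fun _ => c) t 0.
Proof.
intros eps Heps; exists 1; split; [lra|]; intros s Hs; nra.
Qed.

Lemma dini_le_plus (f1 f2 : R -> R) (t d1 d2 : R) :
  dini_le f1 t d1 -> dini_le f2 t d2 ->
  dini_le (fun s => f1 s + f2 s) t (d1 + d2).
Proof.
intros H1 H2 eps Heps.
destruct (H1 (eps / 2)) as [e1 [He1 K1]]; [lra|].
destruct (H2 (eps / 2)) as [e2 [He2 K2]]; [lra|].
exists (Rmin e1 e2); split; [now apply Rmin_glb_lt|].
intros s Hs.
assert (A1 := Rmin_l e1 e2); assert (A2 := Rmin_r e1 e2).
specialize (K1 s); specialize (K2 s); lra.
Qed.

Lemma dini_le_scal (c : R) (f : R -> R) (t d : R) :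
  0 <= c -> dini_le f t d -> dini_le (fun s => c * f s) t (c * d).
Proof.
intros Hc Hf eps Heps.
destruct (Hf (eps / (c + 1))) as [e [He K]].
  apply Rdiv_lt_0_compat; lra.
exists e; split; [easy|]; intros s Hs; specialize (K s Hs).
assert (B : c * (eps / (c + 1)) <= eps).
  replace (c * (eps / (c + 1))) with (eps - eps / (c + 1)) by (field; lra).
  assert (0 < eps / (c + 1)) by (apply Rdiv_lt_0_compat; lra); lra.
set (e' := eps / (c + 1)) in *.
apply Rle_trans with (c * (f t + (s - t) * (d + e'))).
  now apply Rmult_le_compat_l.
assert ((s - t) * (c * e') <= (s - t) * eps)
  by (apply Rmult_le_compat_l; lra).
lra.
Qed.

(** The one-sided bound on [f s] can be squared only because [f] is nonnegative. Both the slack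
    [2 * f t * e] and the quadratic remainder [(s - t) * (d + e) ^ 2] are kept below [eps / 2]. *)
Lemma dini_le_sqr (f : R -> R) (t d : R) :
  (forall s, 0 <= f s) -> dini_le f t d ->
  dini_le (fun s => f s ^ 2) t (2 * f t * d).
Proof.
intros Hpos Hf eps Heps.
assert (Hft := Hpos t).
set (e := eps / (4 * (f t + 1))).
assert (He : 0 < e) by (apply Rdiv_lt_0_compat; lra).
assert (Hfe : f t * e <= eps / 4).
  replace (f t * e) with (eps / 4 - e) by (unfold e; field; lra); lra.
destruct (Hf e He) as [e1 [He1 K]].
set (M := (d + e) ^ 2 + 1).
assert (HM : 0 < M) by (unfold M; assert (H := pow2_ge_0 (d + e)); lra).
assert (HeM : 0 < eps / (2 * M)) by (apply Rdiv_lt_0_compat; lra).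
exists (Rmin e1 (eps / (2 * M))); split; [now apply Rmin_glb_lt|].
intros s Hs.
assert (A1 := Rmin_l e1 (eps / (2 * M))).
assert (A2 := Rmin_r e1 (eps / (2 * M))).
assert (K1 := K s ltac:(lra)).
assert (Hfs := Hpos s).
assert (HsM : (s - t) * M <= eps / 2).
  replace (eps / 2) with (eps / (2 * M) * M) by (field; lra).
  apply Rmult_le_compat_r; lra.
apply Rle_trans with ((f t + (s - t) * (d + e)) ^ 2).
  apply pow_incr; lra.
assert (B : (s - t) * (d + e) ^ 2 <= eps / 2) by (unfold M in HsM; lra).
assert (0 < s - t) by lra.
replace ((f t + (s - t) * (d + e)) ^ 2)
  with (f t ^ 2 + (s - t) * (2 * f t * d + 2 * (f t * e) + (s - t) * (d + e) ^ 2))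
  by ring.
apply Rplus_le_compat_l, Rmult_le_compat_l; lra.
Qed.

(** Up to [o(s - t)], [f s] is [(1 - (s - t) * m) * f t + (s - t) * (r + m * f t)]. The factor of
    [f t] is nonnegative for [s] close to [t], so the triangle inequality preserves the damping
    [- m], whatever the sign of [f t]. *)
Lemma dini_le_abs (f : R -> R) (t r m d : R) :
  (forall eps, 0 < eps -> exists delta, 0 < delta /\
     forall s, t < s < t + delta -> Rabs (f s - f t - (s - t) * r) <= eps * (s - t)) ->
  Rabs (r + m * f t) <= d ->
  dini_le (fun s => Rabs (f s)) t (d - m * Rabs (f t)).
Proof.
intros Hf Hr eps Heps.
destruct (Hf eps Heps) as [e [He K]].
assert (Hm : 0 < / (Rabs m + 1)).
  apply Rinv_0_lt_compat; assert (H := Rabs_pos m); lra.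
exists (Rmin e (/ (Rabs m + 1))); split; [now apply Rmin_glb_lt|].
intros s Hs.
assert (A1 := Rmin_l e (/ (Rabs m + 1))).
assert (A2 := Rmin_r e (/ (Rabs m + 1))).
specialize (K s ltac:(lra)).
assert (Hsm : 0 <= 1 - (s - t) * m).
  assert ((s - t) * (Rabs m + 1) <= 1).
    assert (Hp := Rabs_pos m).
    apply Rle_trans with (/ (Rabs m + 1) * (Rabs m + 1)).
      apply Rmult_le_compat_r; lra.
    right; field; lra.
  assert (Hp := Rle_abs m); nra.
replace (f s) with ((f s - f t - (s - t) * r)
   + ((1 - (s - t) * m) * f t + (s - t) * (r + m * f t))) by ring.
eapply Rle_trans; [apply Rabs_triang|].
eapply Rle_trans; [apply Rplus_le_compat; [exact K|apply Rabs_triang]|].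
rewrite !Rabs_mult, (Rabs_pos_eq (1 - _)), (Rabs_pos_eq (s - t)) by lra.
assert ((s - t) * Rabs (r + m * f t) <= (s - t) * d)
  by (apply Rmult_le_compat_l; lra).
lra.
Qed.

(** * Comparison principle and Gronwall inequality *)

(** Let [m] be the supremum of the times in [[0, T]] where [g] is at most 0. Continuity gives
    [g m <= 0], and [g] stays at most 0 just after [m]: by continuity if [g m < 0], by hypothesis if
    [g m = 0]. So [m < T] is impossible. *)
Lemma continuous_le_stays_le (g : R -> R) (T : R) :
  0 <= T -> (forall t, continuous g t) -> g 0 <= 0 ->
  (forall t, 0 <= t < T -> g t = 0 ->
     exists delta, 0 < delta /\ forall s, t < s < t + delta -> g s <= 0) ->
  g T <= 0.
Proof.
intros HT Hc H0 Hstep.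
destruct (Rle_dec (g T) 0) as [|Hn]; [easy|exfalso].
assert (Hloc : forall t eps, 0 < eps -> exists delta, 0 < delta /\
   forall s, Rabs (s - t) < delta -> Rabs (g s - g t) < eps).
  intros t eps Heps.
  destruct (proj1 (filterlim_locally _ _) (Hc t) (mkposreal eps Heps)) as [dl Hd].
  exists dl; split; [apply cond_pos|]; intros s Hs; exact (Hd s Hs).
set (E := fun s => 0 <= s <= T /\ g s <= 0).
destruct (completeness E) as [m [Hub Hlub]].
  exists T; intros s [Hs _]; lra.
  exists 0; split; lra.
assert (Hm : 0 <= m) by (apply Hub; split; lra).
assert (HmT : m <= T) by (apply Hlub; intros s [Hs _]; lra).
assert (Hgm : g m <= 0).
  destruct (Rle_dec (g m) 0) as [|Hgm]; [easy|exfalso].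
  destruct (Hloc m (g m)) as [dl [Hdl Hd]]; [lra|].
  assert (Hc' : is_upper_bound E (m - dl)).
    intros s Hs; destruct (Rle_dec s (m - dl)) as [|Hsm]; [easy|exfalso].
    assert (s <= m) by now apply Hub.
    assert (Hx := Hd s ltac:(apply Rabs_def1; lra)).
    destruct Hs as [_ Hs]; apply Rabs_def2 in Hx; lra.
  specialize (Hlub _ Hc'); lra.
assert (HmT' : m < T) by (destruct HmT as [|HmT]; [easy|subst; lra]).
assert (Hext : exists delta, 0 < delta /\ forall s, m < s < m + delta -> g s <= 0).
  destruct Hgm as [Hgm|Hgm]; [|apply Hstep; lra].
  destruct (Hloc m (- g m)) as [dl [Hdl Hd]]; [lra|].
  exists dl; split; [easy|]; intros s Hs.
  assert (Hx := Hd s ltac:(apply Rabs_def1; lra)); apply Rabs_def2 in Hx; lra.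
destruct Hext as [dl [Hdl Hd]].
set (s := m + Rmin dl (T - m) / 2).
assert (A1 := Rmin_l dl (T - m)); assert (A2 := Rmin_r dl (T - m)).
assert (A3 : 0 < Rmin dl (T - m)) by (apply Rmin_glb_lt; lra).
assert (s <= m); [|unfold s in *; lra].
apply Hub; split; [unfold s; lra|apply Hd; unfold s; lra].
Qed.

Lemma dini_comparison (f G G' : R -> R) (T : R) :
  0 <= T -> (forall t, continuous f t) ->
  (forall t, is_derive G t (G' t)) -> f 0 <= G 0 ->
  (forall t, 0 <= t < T -> f t = G t -> exists d, d < G' t /\ dini_le f t d) ->
  f T <= G T.
Proof.
intros HT Hf HG H0 Hstep.
enough (f T - G T <= 0) by lra.
apply (continuous_le_stays_le (fun t => f t - G t)); [easy| |lra|].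
  intros t; apply (continuous_minus (V := R_NormedModule)); [apply Hf|].
  apply ex_derive_continuous; eexists; apply HG.
intros t Ht Heq.
destruct (Hstep t Ht ltac:(lra)) as [d [Hd Hdini]].
(* Half of the gap, so that the upper slope [d + eps] of [f] meets the lower slope [G' t - eps] of
   [G]. *)
set (eps := (G' t - d) / 2).
assert (Heps : 0 < eps) by (unfold eps; lra).
destruct (Hdini eps Heps) as [e [He K]].
destruct (HG t) as [_ HGt].
destruct (HGt t (fun P HP => HP) (mkposreal eps Heps)) as [e' K'].
exists (Rmin e e'); split; [apply Rmin_glb_lt; [easy|apply cond_pos]|].
intros s Hs.
assert (A1 := Rmin_l e e'); assert (A2 := Rmin_r e e').
specialize (K s ltac:(lra)).
assert (Hb : ball t e' s) by (apply Rabs_def1; unfold minus, plus, opp; simpl; lra).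
specialize (K' s Hb).
unfold minus, plus, opp, scal, norm in K'; simpl in K'.
unfold abs, mult in K'; simpl in K'.
rewrite (Rabs_pos_eq (s + - t)) in K' by lra.
assert (K1 := Rle_trans _ _ _ (Rle_abs _) K').
assert (K2 := Rle_trans _ _ _ (Rle_abs (- _)) (eq_ind_r (fun x => x <= _) K' (Rabs_Ropp _))).
assert (Hsum : (s - t) * (d + eps) = (s - t) * (G' t - eps)) by (unfold eps; field).
lra.
Qed.

(** The function [exp (- c * t) * f 0 + b / c] solves [G' = - c * G + b] and starts above [f 0].
    Raising it by [eps] makes the slopes strictly ordered wherever it meets [f]. *)
Lemma dini_gronwall (f : R -> R) (T c b : R) :
  0 <= T -> 0 < c -> (forall t, continuous f t) ->
  (forall t, 0 <= t < T -> dini_le f t (- c * f t + b)) -> 0 <= b ->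
  f T <= exp (- c * T) * f 0 + b / c.
Proof.
intros HT Hc Hf Hd Hb.
apply le_epsilon; intros eps Heps.
apply (dini_comparison f (fun t => exp (- c * t) * f 0 + b / c + eps)
   (fun t => - c * (exp (- c * t) * f 0))); [easy|easy| | |].
- intros t; auto_derive; [easy|ring].
- rewrite Rmult_0_r, exp_0.
  assert (0 <= b / c) by (apply Rdiv_le_0_compat; lra); lra.
- intros t Ht Heq; exists (- c * f t + b); split; [|now apply Hd].
  rewrite Heq.
  replace (- c * (exp (- c * t) * f 0 + b / c + eps) + b)
    with (- c * (exp (- c * t) * f 0) - c * eps) by (field; lra).
  nra.
Qed.

(** * Partial sums and series of nonnegative terms *)

(** Unlike [sum_n], this has an empty sum at rank 0, which starts the inductions; hence the shift in
    [psum_sum_n]. *)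
Fixpoint psum (a : nat -> R) (n : nat) : R :=
  match n with O => 0 | S n => psum a n + a n end.

Lemma psum_le (a b : nat -> R) (n : nat) :
  (forall i, (i < n)%nat -> a i <= b i) -> psum a n <= psum b n.
Proof.
induction n as [|n IH]; simpl; intros H; [lra|].
apply Rplus_le_compat; [apply IH; intros i Hi|]; apply H; lia.
Qed.

Lemma psum_nonneg (a : nat -> R) (n : nat) :
  (forall i, (i < n)%nat -> 0 <= a i) -> 0 <= psum a n.
Proof.
induction n as [|n IH]; simpl; intros H; [lra|].
apply Rplus_le_le_0_compat; [apply IH; intros i Hi|]; apply H; lia.
Qed.

Lemma psum_plus (a b : nat -> R) (n : nat) :
  psum (fun i => a i + b i) n = psum a n + psum b n.
Proof. induction n as [|n IH]; simpl; [|rewrite IH]; ring. Qed.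

Lemma psum_scal (c : R) (a : nat -> R) (n : nat) :
  psum (fun i => c * a i) n = c * psum a n.
Proof. induction n as [|n IH]; simpl; [|rewrite IH]; ring. Qed.

Lemma psum_le_mono (a : nat -> R) (m n : nat) :
  (forall i, 0 <= a i) -> (m <= n)%nat -> psum a m <= psum a n.
Proof.
intros Ha Hmn; induction Hmn as [|n Hmn IH]; [lra|simpl].
specialize (Ha n); lra.
Qed.

Lemma psum_sum_n (a : nat -> R) (n : nat) : sum_n a n = psum a (S n).
Proof.
induction n as [|n IH]; [rewrite sum_O; simpl; ring|].
rewrite sum_Sn, IH; reflexivity.
Qed.

Lemma psum_le_Series (a : nat -> R) (n : nat) :
  (forall i, 0 <= a i) -> ex_series a -> psum a n <= Series a.
Proof.
intros Ha Hex.
apply Rle_trans with (psum a (S n)).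
  simpl; specialize (Ha n); lra.
rewrite <- psum_sum_n.
apply (is_lim_seq_incr_compare (sum_n a)).
  exact (Series_correct a Hex).
intros k; rewrite sum_Sn; specialize (Ha (S k)); unfold plus; simpl; lra.
Qed.

Lemma Series_le_bound (a : nat -> R) (M : R) :
  (forall i, 0 <= a i) -> (forall n, psum a n <= M) ->
  ex_series a /\ Series a <= M.
Proof.
intros Ha HM.
assert (Hex : ex_series a).
  destruct (ex_finite_lim_seq_incr (sum_n a) M) as [l Hl].
  - intros k; rewrite sum_Sn; specialize (Ha (S k)); unfold plus; simpl; lra.
  - intros k; rewrite psum_sum_n; apply HM.
  - exists l; exact Hl.
split; [easy|].
apply (is_lim_seq_le (sum_n a) (fun _ => M) (Series a) M).
- intros k; rewrite psum_sum_n; apply HM.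
- exact (Series_correct a Hex).
- apply is_lim_seq_const.
Qed.

Lemma dini_le_psum (f : R -> nat -> R) (d : nat -> R) (t : R) (n : nat) :
  (forall i, (i < n)%nat -> dini_le (fun s => f s i) t (d i)) ->
  dini_le (fun s => psum (f s) n) t (psum d n).
Proof.
induction n as [|n IH]; simpl; intros H; [apply dini_le_const|].
apply (dini_le_plus (fun s => psum (f s) n) (fun s => f s n)).
- apply IH; intros i Hi; apply H; lia.
- apply H; lia.
Qed.

Lemma continuous_psum (f : R -> nat -> R) (n : nat) (t : R) :
  (forall i, continuous (fun s => f s i) t) ->
  continuous (fun s => psum (f s) n) t.
Proof.
intros H; induction n as [|n IH]; simpl; [apply continuous_const|].
apply (continuous_plus (V := R_NormedModule)); [exact IH|apply H].
Qed.

(** * Truncated tails, Hardy inequality and energy dissipation *)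

(** As a difference of partial sums it satisfies [tail_head] at every index, even past [n]. *)
Definition tail (z : nat -> R) (n i : nat) : R := psum z n - psum z i.

Lemma tail_head (z : nat -> R) (n i : nat) : tail z n i = z i + tail z n (S i).
Proof. unfold tail; simpl; ring. Qed.

Lemma tail_nonneg (z : nat -> R) (n i : nat) :
  (forall j, 0 <= z j) -> (i <= n)%nat -> 0 <= tail z n i.
Proof.
intros Hz Hi; unfold tail; assert (H := psum_le_mono z i n Hz Hi); lra.
Qed.

(** The inequalities at the indices from [i] to [n - 1] telescope, leaving only the fluxes through
    the two ends of the block. *)
Lemma dini_le_tail (z : R -> nat -> R) (p : nat -> R) (b t : R) (n : nat) :
  (forall i, dini_le (fun s => z s i) t (p i - p (S i) - b * z t i + b * z t (S i))) ->
  forall i, (i <= n)%nat ->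
  dini_le (fun s => tail (z s) n i) t (p i - p n - b * z t i + b * z t n).
Proof.
intros Hz i Hi; replace n with (i + (n - i))%nat by lia.
generalize (n - i)%nat; clear n Hi; intros m; induction m as [|m IH].
- rewrite Nat.add_0_r.
  apply dini_le_weaken with 0; [right; ring|].
  intros eps Heps; destruct (dini_le_const 0 t eps Heps) as [e [He K]].
  exists e; split; [easy|]; intros s Hs; specialize (K s Hs).
  unfold tail; lra.
- replace (i + S m)%nat with (S (i + m)) by lia.
  apply dini_le_weaken with
    ((p i - p (i + m)%nat - b * z t i + b * z t (i + m)%nat) +
     (p (i + m)%nat - p (S (i + m)) - b * z t (i + m)%nat + b * z t (S (i + m))));
    [right; ring|].
  intros eps Heps.
  destruct (dini_le_plus _ _ _ _ _ IH (Hz (i + m)%nat) eps Heps) as [e [He K]].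
  exists e; split; [easy|]; intros s Hs; specialize (K s Hs).
  unfold tail in *; cbn [psum]; lra.
Qed.

(** Summation by parts: [T i = z i + T (S i)] splits the loss [b * h i * T i * z i] into the
    dissipation [b * h i * z i ^ 2] and a cross term [b * h i * z i * T (S i)], which dominates the
    gain [h (S i) * T (S i) * p (S i)] at the next index. The induction carries the cross term not
    yet spent. *)
Lemma energy_dissipation (z T p h : nat -> R) (b : R) (n : nat) :
  (forall i, T i = z i + T (S i)) -> (forall i, (i <= n)%nat -> 0 <= T i) ->
  p 0%nat = 0 -> (forall i, h (S i) * p (S i) <= b * h i * z i) ->
  (forall i, 0 <= b * h i * z i) ->
  psum (fun i => h i * T i * (p i - b * z i)) n <=
    - b * psum (fun i => h i * z i ^ 2) n.
Proof.
intros HT HT0 Hp0 Hp Hz.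
enough (H : forall m, (m <= n)%nat ->
  psum (fun i => h i * T i * (p i - b * z i)) m
  + b * psum (fun i => h i * z i ^ 2) m
  + match m with O => 0 | S i => b * h i * z i * T m end <= 0).
  specialize (H n (le_n n)).
  assert (0 <= match n with O => 0 | S i => b * h i * z i * T n end).
    destruct n; [lra|apply Rmult_le_pos; auto].
  lra.
intros m; induction m as [|m IH]; intros Hm; cbn [psum]; [lra|].
specialize (IH ltac:(lia)).
assert (Hflux : h m * T m * p m <=
   match m with O => 0 | S i => b * h i * z i * T m end).
  destruct m as [|m]; [rewrite Hp0; lra|].
  replace (h (S m) * T (S m) * p (S m)) with (h (S m) * p (S m) * T (S m)) by ring.
  apply Rmult_le_compat_r; [apply HT0; lia|apply Hp].
assert (Hsplit : h m * T m * (p m - b * z m) + b * (h m * z m ^ 2)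
   + b * h m * z m * T (S m) = h m * T m * p m) by (rewrite (HT m); ring).
lra.
Qed.

(** One step of the recursion for [T], estimated by Young's inequality, bounds the weighted square
    of [T m] by that of [z m] plus [(1 + theta) / 2] times that of [T (S m)]. This factor is below 1
    since the weights grow by [1 / theta], so the shifted sum is absorbed on the left. *)
Lemma hardy_tail (theta : R) (z T : nat -> R) (n : nat) :
  0 < theta < 1 -> (forall i, T i = z i + T (S i)) -> T n = 0 ->
  psum (fun i => T i ^ 2 / theta ^ S i) n <=
    2 * (1 + theta) / (1 - theta) ^ 2 * psum (fun i => z i ^ 2 / theta ^ S i) n.
Proof.
intros Hth HT Hn.
set (c := (1 + theta) / (1 - theta)).
enough (H : forall m, (1 - theta) / 2 * psum (fun i => T i ^ 2 / theta ^ S i) m <=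
   c * psum (fun i => z i ^ 2 / theta ^ S i) m
   + (1 + theta) / 2 * (T m ^ 2 / theta ^ S m)).
  specialize (H n); rewrite Hn in H.
  replace ((1 + theta) / 2 * (0 ^ 2 / theta ^ S n)) with 0 in H
    by (field; apply pow_nonzero; lra).
  apply Rmult_le_reg_l with ((1 - theta) / 2); [lra|].
  eapply Rle_trans; [exact H|right; unfold c; field; lra].
intros m; induction m as [|m IH].
  cbn [psum]; rewrite !Rmult_0_r, Rplus_0_l.
  apply Rmult_le_pos; [lra|]; apply Rdiv_le_0_compat; [apply pow2_ge_0|].
  apply pow_lt; lra.
cbn [psum].
assert (Hpos : 0 < theta ^ S m) by (apply pow_lt; lra).
enough (Hstep : T m ^ 2 / theta ^ S m <= c * (z m ^ 2 / theta ^ S m)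
   + (1 + theta) / 2 * (T (S m) ^ 2 / theta ^ S (S m))) by lra.
change (theta ^ S (S m)) with (theta * theta ^ S m).
replace (c * (z m ^ 2 / theta ^ S m)
   + (1 + theta) / 2 * (T (S m) ^ 2 / (theta * theta ^ S m)))
  with ((c * z m ^ 2 + (1 + theta) / (2 * theta) * T (S m) ^ 2) / theta ^ S m)
  by (field; lra).
apply Rmult_le_compat_r; [now left; apply Rinv_0_lt_compat|].
rewrite (HT m).
(* This quotient is exactly the difference of the two sides of the Young inequality being proved. *)
assert (Hsq : 0 <= (2 * theta * z m - (1 - theta) * T (S m)) ^ 2 /
   (2 * theta * (1 - theta))).
  apply Rdiv_le_0_compat; [apply pow2_ge_0|]; nra.
apply Rminus_le_0; eapply Rle_trans; [exact Hsq|].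
right; unfold c; field; lra.
Qed.

(** Truncation at [n] adds two boundary terms to the derivative of a tail: [- p n] has the
    favourable sign, and [b * z t n] is split off by Young's inequality at the cost of half the
    dissipation [2 * b * Y]. The other half gives the rate [b / K]. *)
Lemma dini_energy (z : R -> nat -> R) (p h : nat -> R) (b K t : R) (n : nat) :
  0 < b -> 0 < K -> (forall s i, 0 <= z s i) -> (forall i, 0 <= h i) ->
  (forall i, 0 <= p i) -> p 0%nat = 0 ->
  (forall i, h (S i) * p (S i) <= b * h i * z t i) ->
  (forall i, dini_le (fun s => z s i) t (p i - p (S i) - b * z t i + b * z t (S i))) ->
  psum (fun i => h i * tail (z t) n i ^ 2) n <=
    K * psum (fun i => h i * z t i ^ 2) n ->
  dini_le (fun s => psum (fun i => h i * tail (z s) n i ^ 2) n) t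
    (- (b / K) * psum (fun i => h i * tail (z t) n i ^ 2) n
     + b * K * z t n ^ 2 * psum h n).
Proof.
intros Hb HK Hz Hh Hp Hp0 Hhp Hdini Hhardy.
set (T := tail (z t) n) in *.
assert (HT : forall i, (i <= n)%nat -> 0 <= T i)
  by (intros i Hi; apply tail_nonneg; auto).
apply dini_le_weaken with
  (psum (fun i => h i * (2 * T i * (p i - p n - b * z t i + b * z t n))) n).
- apply Rle_trans with (psum (fun i => 2 * (h i * T i * (p i - b * z t i))
    + (b / K * (h i * T i ^ 2) + b * K * z t n ^ 2 * h i)) n).
    apply psum_le; intros i Hi; specialize (HT i ltac:(lia)).
    assert (Hyoung : 2 * T i * (b * z t n) <= b / K * T i ^ 2 + b * K * z t n ^ 2).
      assert (0 <= b / K * (T i - K * z t n) ^ 2).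
        apply Rmult_le_pos; [apply Rdiv_le_0_compat; lra|apply pow2_ge_0].
      replace (b / K * T i ^ 2 + b * K * z t n ^ 2) with
        (2 * T i * (b * z t n) + b / K * (T i - K * z t n) ^ 2) by (field; lra).
      lra.
    assert (H1 := Rmult_le_compat_l (h i) _ _ (Hh i) Hyoung).
    assert (0 <= h i * T i * p n)
      by (apply Rmult_le_pos; [apply Rmult_le_pos|]; auto).
    lra.
  rewrite psum_plus, psum_plus, !psum_scal.
  assert (Hdiss := energy_dissipation (z t) T p h b n (tail_head (z t) n) HT
     Hp0 Hhp ltac:(intros i; apply Rmult_le_pos; [apply Rmult_le_pos; [lra|]|]; auto)).
  set (E := psum (fun i => h i * T i ^ 2) n) in *.
  set (Y := psum (fun i => h i * z t i ^ 2) n) in *.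
  assert (Hkey : b / K * E <= b * Y).
    replace (b * Y) with (b / K * (K * Y)) by (field; lra).
    apply Rmult_le_compat_l; [apply Rdiv_le_0_compat|]; lra.
  lra.
- apply dini_le_psum; intros i Hi.
  apply dini_le_scal; [easy|].
  apply (dini_le_sqr (fun s => tail (z s) n i)).
    intros s; apply tail_nonneg; [auto|lia].
  apply (dini_le_tail z p b t n Hdini i); lia.
Qed.

(** * The power nonlinearity and the stationary point *)

(** The factor [a] is the sum of the products [x ^ i * y ^ (L - 1 - i)]: the term free of [y] is at
    most 1 and each other term is at most [y]. At a stationary [y] of rank [k] it is thus close to 1
    for large [k]. *)
Lemma pow_minus_factor (L : nat) (x y : R) :
  (1 <= L)%nat -> 0 <= x <= 1 -> 0 <= y <= 1 ->
  exists a, 0 <= a <= 1 + INR L * y /\ x ^ L - y ^ L = a * (x - y).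
Proof.
intros HL Hx Hy; induction HL as [|L HL [a [[Ha0 Ha] Heq]]].
  exists 1; simpl; split; [lra|ring].
exists (x * a + y ^ L).
assert (Hy0 : 0 <= y ^ L) by (apply pow_le; lra).
assert (HyL : y ^ L <= y).
  destruct L as [|L]; [lia|]; simpl.
  assert (y ^ L <= 1) by (rewrite <- (pow1 L); apply pow_incr; lra); nra.
split; [rewrite S_INR; split; nra|].
change (x * x ^ L - y * y ^ L = (x * a + y ^ L) * (x - y)).
replace (x * x ^ L - y * y ^ L) with (x * (x ^ L - y ^ L) + y ^ L * (x - y)) by ring.
rewrite Heq; ring.
Qed.

Lemma geom_exponent_0 (L : nat) : geom_exponent L 0 = 0%nat.
Proof.
unfold geom_exponent; simpl; destruct (Nat.eqb L 1); [easy|].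
destruct L as [|[|L]]; [easy|easy|apply Nat.div_small; simpl; lia].
Qed.

Lemma geom_exponent_S (L k : nat) :
  (1 <= L)%nat -> geom_exponent L (S k) = (L * geom_exponent L k + 1)%nat.
Proof.
intros HL; unfold geom_exponent.
destruct (Nat.eqb_spec L 1) as [->|HL1]; [lia|].
destruct L as [|d]; [lia|].
(* [L ^ k] is 1 modulo [L - 1], so both divisions are exact. *)
assert (Hk : exists m, (S d ^ k = m * d + 1)%nat).
  induction k as [|k [m Hm]]; [exists 0%nat; reflexivity|].
  exists (S d * m + 1)%nat; rewrite Nat.pow_succ_r', Hm; lia.
destruct Hk as [m Hm].
replace (S d ^ S k - 1)%nat with ((S d * m + 1) * (S d - 1))%nat
  by (rewrite Nat.pow_succ_r', Hm, Nat.sub_1_r; simpl Nat.pred; lia).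
replace (S d ^ k - 1)%nat with (m * (S d - 1))%nat
  by (rewrite Hm, Nat.sub_1_r; simpl Nat.pred; lia).
rewrite !Nat.div_mul; lia.
Qed.

Lemma u_tilde_0 (rho : R) (L : nat) : u_tilde rho L 0 = 1.
Proof. unfold u_tilde; rewrite geom_exponent_0; reflexivity. Qed.

(** With [rho = alpha / beta] this is detailed balance, [beta * v (S k) = alpha * v k ^ L], which
    makes the right-hand side of the equation vanish. *)
Lemma u_tilde_S (rho : R) (L k : nat) :
  (1 <= L)%nat -> u_tilde rho L (S k) = rho * u_tilde rho L k ^ L.
Proof.
intros HL; unfold u_tilde; rewrite geom_exponent_S by easy.
rewrite Nat.add_1_r, <- pow_mult, (Nat.mul_comm _ L); reflexivity.
Qed.

Lemma u_tilde_bounds (rho : R) (L k : nat) :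
  (1 <= L)%nat -> 0 < rho < 1 -> 0 <= u_tilde rho L k <= rho ^ k.
Proof.
intros HL Hrho; induction k as [|k IH]; [rewrite u_tilde_0; simpl; lra|].
rewrite u_tilde_S by easy; simpl.
assert (Hk : rho ^ k <= 1) by (rewrite <- (pow1 k); apply pow_incr; lra).
assert (Hle : u_tilde rho L k ^ L <= u_tilde rho L k).
  destruct L as [|L]; [lia|].
  assert (u_tilde rho (S L) k ^ L <= 1)
    by (rewrite <- (pow1 L); apply pow_incr; lra).
  change (u_tilde rho (S L) k * u_tilde rho (S L) k ^ L <= u_tilde rho (S L) k); nra.
assert (0 <= u_tilde rho L k ^ L) by (apply pow_le; lra).
split; [apply Rmult_le_pos|apply Rmult_le_compat_l]; lra.
Qed.

Lemma in_V_bounds (v : nat -> R) (k : nat) : in_V v -> 0 <= v k <= 1.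
Proof.
intros [H0 [Hdec Hlim]]; split.
  apply (is_lim_seq_decr_compare v 0 Hlim Hdec).
induction k as [|k IH]; [lra|].
specialize (Hdec k); lra.
Qed.

(** * Regularity of solutions and the inequality for absolute differences *)

(** The form of differentiability that [dini_le_abs] takes as hypothesis; it looks only at times
    after [t], hence also applies at [t = 0]. *)
Definition right_derivative (f : R -> R) (t r : R) : Prop :=
  forall eps, 0 < eps -> exists delta, 0 < delta /\
    forall s, t < s < t + delta -> Rabs (f s - f t - (s - t) * r) <= eps * (s - t).

Lemma dini_le_right_derivative (f : R -> R) (t r : R) :
  right_derivative f t r -> dini_le f t r.
Proof.
intros Hf eps Heps; destruct (Hf eps Heps) as [e [He K]].
exists e; split; [easy|]; intros s Hs; specialize (K s Hs).
assert (H := Rle_trans _ _ _ (Rle_abs _) K); lra.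
Qed.

Lemma V_solution_differentiable alpha beta L u0 u (t : R) (k : nat) :
  is_V_solution alpha beta L u0 u -> 0 <= t ->
  forall eps, 0 < eps -> exists delta, 0 < delta /\
    forall s, 0 <= s -> Rabs (s - t) < delta ->
    Rabs (u s (S k) - u t (S k) - (s - t) * ode_rhs alpha beta L (u t) (S k))
      <= eps * Rabs (s - t).
Proof.
intros [_ [_ Hd]] Ht eps Heps.
destruct (Hd t (S k) Ht ltac:(lia)) as [_ H].
destruct (H t (fun P HP => filter_le_within _ _ HP) (mkposreal eps Heps)) as [dl K].
exists dl; split; [apply cond_pos|]; intros s Hs Hst.
exact (K s Hst Hs).
Qed.

(* [Rmax 0 s] discards the unconstrained values of [u] at negative times. *)
Lemma V_solution_continuous alpha beta L u0 u (t : R) (k : nat) :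
  is_V_solution alpha beta L u0 u ->
  continuous (fun s => u (Rmax 0 s) k) t.
Proof.
intros Hu; destruct k as [|k].
  apply continuous_ext with (fun _ => 1); [|apply continuous_const].
  intros s; symmetry; apply (proj1 (proj2 Hu)), Rmax_l.
apply filterlim_locally; intros eps.
set (t' := Rmax 0 t).
assert (Ht' : 0 <= t') by apply Rmax_l.
destruct (V_solution_differentiable _ _ _ _ _ t' k Hu Ht' 1 Rlt_0_1) as [dl [Hdl K]].
set (r := ode_rhs alpha beta L (u t') (S k)) in *.
assert (Hr : 0 < 1 + Rabs r) by (assert (H := Rabs_pos r); lra).
assert (Hd : 0 < Rmin dl (eps / (1 + Rabs r))).
  apply Rmin_glb_lt; [easy|apply Rdiv_lt_0_compat; [apply cond_pos|easy]].
exists (mkposreal _ Hd); intros s Hs.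
assert (Hs' : Rabs (s - t) < Rmin dl (eps / (1 + Rabs r))) by exact Hs.
assert (Hmax : Rabs (Rmax 0 s - t') <= Rabs (s - t)).
  unfold t'; apply Rabs_le; assert (H := Rle_abs (s - t));
  assert (H' := Rle_abs (- (s - t))); rewrite Rabs_Ropp in H';
  assert (H0 := Rabs_pos (s - t));
  unfold Rmax; destruct (Rle_dec 0 s), (Rle_dec 0 t); lra.
set (s' := Rmax 0 s) in *.
assert (A1 := Rmin_l dl (eps / (1 + Rabs r))).
assert (A2 := Rmin_r dl (eps / (1 + Rabs r))).
specialize (K s' (Rmax_l _ _) ltac:(lra)).
change (Rabs (u s' (S k) - u t' (S k)) < eps).
replace (u s' (S k) - u t' (S k)) with
  ((u s' (S k) - u t' (S k) - (s' - t') * r) + (s' - t') * r) by ring.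
eapply Rle_lt_trans; [apply Rabs_triang|].
rewrite Rabs_mult.
apply Rle_lt_trans with ((1 + Rabs r) * Rabs (s' - t')); [lra|].
apply Rlt_le_trans with ((1 + Rabs r) * (eps / (1 + Rabs r))).
  apply Rmult_lt_compat_l; lra.
right; field; lra.
Qed.

Lemma V_solution_right_derivative alpha beta L u0 u (t : R) (k : nat) :
  is_V_solution alpha beta L u0 u -> 0 <= t ->
  right_derivative (fun s => u (Rmax 0 s) (S k)) t
    (ode_rhs alpha beta L (u t) (S k)).
Proof.
intros Hu Ht eps Heps.
destruct (V_solution_differentiable _ _ _ _ _ t k Hu Ht eps Heps) as [dl [Hdl K]].
exists dl; split; [easy|]; intros s Hs.
rewrite !Rmax_right by lra.
rewrite <- (Rabs_pos_eq (s - t)) at 2 by lra.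
apply K; [|rewrite Rabs_pos_eq]; lra.
Qed.

(** Subtracting the stationary equation and factoring [u ^ L - v ^ L = a * (u - v)] at site [S k]
    exhibits the damping [alpha * a + beta]. Since [a >= 0], the term [alpha * a * |u - v|] is again
    the absolute difference of the powers. *)
Lemma dini_abs_difference alpha beta L u0 u (t : R) (k : nat) :
  0 < alpha < beta -> (1 <= L)%nat ->
  is_V_solution alpha beta L u0 u -> 0 <= t ->
  let v := u_tilde (alpha / beta) L in
  dini_le (fun s => Rabs (u (Rmax 0 s) (S k) - v (S k))) t
    (alpha * Rabs (u t k ^ L - v k ^ L)
     - alpha * Rabs (u t (S k) ^ L - v (S k) ^ L)
     - beta * Rabs (u t (S k) - v (S k))
     + beta * Rabs (u t (S (S k)) - v (S (S k)))).
Proof.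
intros Hab HL Hu Ht v.
assert (HV := proj1 (proj2 Hu) t Ht).
assert (Hrho : 0 < alpha / beta < 1).
  split; [apply Rdiv_lt_0_compat; lra|apply Rlt_div_l; lra].
assert (Hv1 : 0 <= v (S k) <= 1).
  assert (H := u_tilde_bounds (alpha / beta) L (S k) HL Hrho).
  assert ((alpha / beta) ^ S k <= 1)
    by (rewrite <- (pow1 (S k)); apply pow_incr; lra).
  unfold v; lra.
destruct (pow_minus_factor L (u t (S k)) (v (S k)) HL (in_V_bounds _ _ HV) Hv1)
  as [a [[Ha0 _] Ha]].
assert (Hdini := dini_le_abs (fun s => u (Rmax 0 s) (S k) - v (S k)) t
  (ode_rhs alpha beta L (u t) (S k)) (alpha * a + beta)
  (alpha * Rabs (u t k ^ L - v k ^ L) + beta * Rabs (u t (S (S k)) - v (S (S k))))).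
cbv beta in Hdini; rewrite (Rmax_right 0 t Ht) in Hdini.
eapply dini_le_weaken; [|apply Hdini].
- right; rewrite Ha, Rabs_mult, (Rabs_pos_eq a Ha0); ring.
- intros eps Heps.
  destruct (V_solution_right_derivative _ _ _ _ _ t k Hu Ht eps Heps) as [e [He K]].
  exists e; split; [easy|]; intros s Hs; specialize (K s Hs).
  cbv beta in K; rewrite (Rmax_right 0 t Ht) in K.
  match goal with |- Rabs ?x <= _ => match type of K with Rabs ?y <= _ =>
    replace x with y by ring end end; exact K.
- assert (Hst : ode_rhs alpha beta L (u t) (S k)
      + (alpha * a + beta) * (u t (S k) - v (S k))
    = alpha * (u t k ^ L - v k ^ L) + beta * (u t (S (S k)) - v (S (S k)))).
    unfold ode_rhs.
    replace (S k - 1)%nat with k by lia; replace (S k + 1)%nat with (S (S k)) by lia.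
    assert (Hs1 : beta * v (S k) = alpha * v k ^ L).
      unfold v at 1; rewrite u_tilde_S by easy; fold v; field; lra.
    assert (Hs2 : beta * v (S (S k)) = alpha * v (S k) ^ L).
      unfold v at 1; rewrite u_tilde_S by easy; fold v; field; lra.
    replace ((alpha * a + beta) * (u t (S k) - v (S k))) with
      (alpha * (a * (u t (S k) - v (S k))) + beta * (u t (S k) - v (S k))) by ring.
    rewrite <- Ha; lra.
  rewrite Hst.
  eapply Rle_trans; [apply Rabs_triang|].
  rewrite !Rabs_mult, (Rabs_pos_eq alpha), (Rabs_pos_eq beta) by lra; lra.
Qed.

(** * Decay of solutions in [k], uniform on compact time intervals *)

(** The convolution of [x] with the powers of 1/2. For nonnegative [x] it is a majorant that loses
    at most half of its value per step, which allows one exponential rate for all ranks, and it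
    still tends to 0 when [x] does. *)
Fixpoint damped_sum (x : nat -> R) (n : nat) : R :=
  match n with O => x O | S k => x n + damped_sum x k / 2 end.

Lemma damped_sum_ge (x : nat -> R) (n : nat) :
  (forall k, 0 <= x k) -> x n <= damped_sum x n.
Proof.
intros Hx; enough (x n <= damped_sum x n /\ 0 <= damped_sum x n) by easy.
induction n as [|n IH]; simpl; [specialize (Hx O)|specialize (Hx (S n))]; lra.
Qed.

Lemma damped_sum_pos (x : nat -> R) (n : nat) :
  (forall k, 0 <= x k) -> 0 < x O -> 0 < damped_sum x n.
Proof.
intros Hx H0; induction n as [|n IH]; simpl; [easy|specialize (Hx (S n)); lra].
Qed.

(** Past a rank [N] the terms are below [eps / 4] and contribute at most [eps / 2] altogether; what
    was accumulated up to [N] is halved at each step. *)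
Lemma is_lim_damped_sum (x : nat -> R) :
  (forall k, 0 <= x k) -> is_lim_seq x 0 -> is_lim_seq (damped_sum x) 0.
Proof.
intros Hx Hlim; apply is_lim_seq_spec; intros eps.
assert (Heps := cond_pos eps).
apply is_lim_seq_spec in Hlim.
assert (He4 : 0 < eps / 4) by lra.
destruct (Hlim (mkposreal _ He4)) as [N HN].
assert (HwN : 0 <= damped_sum x N)
  by (eapply Rle_trans; [apply (Hx N)|now apply damped_sum_ge]).
assert (Hbound : forall m, damped_sum x (N + m) <= eps / 2 + damped_sum x N * (/ 2) ^ m).
  induction m as [|m IH]; [rewrite Nat.add_0_r; simpl; lra|].
  rewrite Nat.add_succ_r; simpl.
  specialize (HN (S (N + m)) ltac:(lia)); simpl in HN.
  rewrite Rminus_0_r, Rabs_pos_eq in HN by apply Hx; lra.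
destruct (pow_lt_1_zero (/ 2) ltac:(rewrite Rabs_pos_eq; lra)
   (eps / 2 / (damped_sum x N + 1))) as [M HM].
  apply Rdiv_lt_0_compat; lra.
exists (N + M)%nat; intros n Hn.
rewrite Rminus_0_r, Rabs_pos_eq
  by (eapply Rle_trans; [apply (Hx n)|now apply damped_sum_ge]).
replace n with (N + (n - N))%nat by lia.
eapply Rle_lt_trans; [apply Hbound|].
specialize (HM (n - N)%nat ltac:(lia)).
assert (Hp : 0 < (/ 2) ^ (n - N)) by (apply pow_lt; lra).
rewrite Rabs_pos_eq in HM by lra.
assert (Hlt : (damped_sum x N + 1) * (/ 2) ^ (n - N) < eps / 2).
  apply Rlt_le_trans with ((damped_sum x N + 1) * (eps / 2 / (damped_sum x N + 1))).
    apply Rmult_lt_compat_l; lra.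
  right; field; lra.
lra.
Qed.

(* The majorant [V] solves [alpha * V k < K * V (S k)], so that [V k * exp (K * s)] is a
   supersolution of [u' (S k) <= alpha * u k]. *)
Lemma V_solution_growth alpha beta L u0 u (q s : R) (k : nat) :
  0 < alpha < beta -> (1 <= L)%nat -> 0 < q -> is_V_solution alpha beta L u0 u ->
  0 <= s ->
  u s k <= q ^ k * damped_sum (fun j => u0 j / q ^ j) k * exp ((2 * alpha / q + 1) * s).
Proof.
intros Hab HL Hq Hu.
set (x := fun j => u0 j / q ^ j).
set (V := fun k => q ^ k * damped_sum x k).
set (K := 2 * alpha / q + 1).
change (0 <= s -> u s k <= V k * exp (K * s)).
assert (HV : forall t, 0 <= t -> in_V (u t)) by apply (proj1 (proj2 Hu)).
assert (Hu0 : forall j, u0 j = u 0 j) by (intros j; symmetry; apply (proj1 Hu)).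
assert (Hx : forall j, 0 <= x j).
  intros j; unfold x; rewrite Hu0; apply Rdiv_le_0_compat; [|now apply pow_lt].
  apply in_V_bounds, HV; lra.
assert (Hx0 : x O = 1).
  unfold x; rewrite Hu0, (proj1 (HV 0 (Rle_refl 0))); simpl; field.
assert (HVpos : forall j, 0 < V j).
  intros j; apply Rmult_lt_0_compat; [now apply pow_lt|].
  apply damped_sum_pos; [easy|lra].
assert (HVS : forall j, V (S j) = u0 (S j) + q / 2 * V j).
  intros j; unfold V; simpl; unfold x at 1; simpl; field.
  split; [apply pow_nonzero|]; lra.
assert (HKq : 0 < 2 * alpha / q) by (apply Rdiv_lt_0_compat; lra).
revert s; induction k as [|k IH]; intros s Hs.
  rewrite (proj1 (HV s Hs)); unfold V; simpl; rewrite Hx0.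
  assert (1 <= exp (K * s)); [|lra].
  assert (H := exp_ineq1_le (K * s)); assert (0 <= K * s); [|lra].
  apply Rmult_le_pos; unfold K; lra.
assert (Hcmp := dini_comparison (fun s => u (Rmax 0 s) (S k))
   (fun s => V (S k) * exp (K * s)) (fun s => K * (V (S k) * exp (K * s))) s Hs).
cbv beta in Hcmp; rewrite (Rmax_right 0 s Hs) in Hcmp; apply Hcmp; clear Hcmp.
- intros t; eapply V_solution_continuous; exact Hu.
- intros t; auto_derive; [easy|ring].
- rewrite Rmax_left, <- Hu0, Rmult_0_r, exp_0, Rmult_1_r, HVS by lra.
  specialize (HVpos k); nra.
- intros t Ht _; exists (ode_rhs alpha beta L (u t) (S k)); split.
  + specialize (IH t ltac:(lra)).
    assert (Hv := HV t ltac:(lra)).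
    assert (H0 := in_V_bounds _ k Hv); assert (H1 := in_V_bounds _ (S k) Hv).
    assert (H2 := proj1 (proj2 Hv) (S k)).
    unfold ode_rhs.
    replace (S k - 1)%nat with k by lia; replace (S k + 1)%nat with (S (S k)) by lia.
    assert (HkL : u t k ^ L <= u t k).
      destruct L as [|l]; [lia|].
      assert (u t k ^ l <= 1) by (rewrite <- (pow1 l); apply pow_incr; lra).
      change (u t k * u t k ^ l <= u t k); nra.
    assert (0 <= u t (S k) ^ L) by (apply pow_le; lra).
    (* Only the inflow is kept: the other terms are nonpositive because [u t] is nonnegative and
       nonincreasing. *)
    assert (Hrhs : alpha * (u t k ^ L - u t (S k) ^ L)
       - beta * (u t (S k) - u t (S (S k))) <= alpha * (V k * exp (K * t))) by nra.
    eapply Rle_lt_trans; [exact Hrhs|].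
    rewrite <- !Rmult_assoc; apply Rmult_lt_compat_r; [apply exp_pos|].
    assert (HSk := HVS k); assert (HSpos := HVpos (S k)).
    assert (0 <= u0 (S k)) by (rewrite Hu0; apply in_V_bounds, HV; lra).
    (* From [V (S k) >= q / 2 * V k]. The summand 1 in [K] makes the comparison strict. *)
    assert (Hstep : 2 * alpha / q * (q / 2 * V k) <= 2 * alpha / q * V (S k))
      by (apply Rmult_le_compat_l; lra).
    replace (2 * alpha / q * (q / 2 * V k)) with (alpha * V k) in Hstep by (field; lra).
    unfold K; lra.
  + apply dini_le_right_derivative; eapply V_solution_right_derivative; [exact Hu|lra].
Qed.

Lemma psum_inv_pow_le (theta : R) (n : nat) :
  0 < theta < 1 -> psum (fun i => / theta ^ S i) n <= / ((1 - theta) * theta ^ n).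
Proof.
intros Hth; induction n as [|n IH].
  cbn [psum]; left; apply Rinv_0_lt_compat; simpl; lra.
assert (0 < theta ^ n) by (apply pow_lt; lra).
cbn [psum]; apply Rle_trans with (/ ((1 - theta) * theta ^ n) + / theta ^ S n); [lra|].
right; simpl; field; lra.
Qed.

(** The terms of the convergent series are the squares of the quotients [x k / sqrt theta ^ k]. This
    is the decay of the initial value that [V_solution_growth] propagates. *)
Lemma is_lim_weighted_of_summable (theta : R) (x : nat -> R) :
  0 < theta -> (forall k, 0 <= x k) -> L2_summable (g theta) x ->
  is_lim_seq (fun k => x k / sqrt theta ^ k) 0.
Proof.
intros Hth Hx Hs.
apply is_lim_seq_incr_1.
apply is_lim_seq_ext with (fun k => sqrt (x (S k) ^ 2 / g theta (S k))).
- intros k; unfold g.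
  assert (Hq : 0 < sqrt theta ^ S k) by (apply pow_lt, sqrt_lt_R0, Hth).
  rewrite <- (sqrt_sqrt theta) at 1 by lra.
  rewrite Rpow_mult_distr.
  replace (x (S k) ^ 2 / (sqrt theta ^ S k * sqrt theta ^ S k))
    with (Rsqr (x (S k) / sqrt theta ^ S k)) by (unfold Rsqr; field; lra).
  apply sqrt_Rsqr, Rdiv_le_0_compat; [apply Hx|easy].
- rewrite <- sqrt_0.
  apply (is_lim_seq_continuous sqrt); [apply continuity_pt_sqrt; lra|].
  exact (ex_series_lim_0 _ Hs).
Qed.

(** * Exponential decay of the energy *)

(** The truncated energy dominates the truncated squared norm, because each tail dominates its first
    term, and is at most [K] times it. Here [K] is the Hardy constant times [exp c], the bound on
    [h i * theta ^ S i]. Gronwall's inequality applies to the energy, at the rate [beta / K]. *)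
Lemma V_solution_energy_decay alpha beta L theta u0 u (t : R) :
  0 < alpha < beta -> (1 <= L)%nat -> alpha / beta <= theta < 1 ->
  L2_summable (g theta) u0 -> is_V_solution alpha beta L u0 u -> 0 <= t ->
  L2_summable (g theta) (fun k => u0 k - u_tilde (alpha / beta) L k) ->
  let K := exp (INR L / (1 - alpha / beta)) * (2 * (1 + theta) / (1 - theta) ^ 2) in
  forall m,
  psum (fun i => (u t (S i) - u_tilde (alpha / beta) L (S i)) ^ 2 / g theta (S i)) m <=
    exp (- (beta / K) * t) * K *
    Series (fun i => (u0 (S i) - u_tilde (alpha / beta) L (S i)) ^ 2 / g theta (S i)).
Proof.
intros Hab HL Hth Hs0 Hu Ht Hdiff.
set (rho := alpha / beta) in *.
set (v := u_tilde rho L) in *.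
set (c := INR L / (1 - rho)).
set (C0 := 2 * (1 + theta) / (1 - theta) ^ 2); intros K m.
set (S0 := Series _).
assert (Hrho : 0 < rho < 1).
  unfold rho; split; [apply Rdiv_lt_0_compat; lra|apply Rlt_div_l; lra].
assert (Hth01 : 0 < theta < 1) by lra.
assert (HVs : forall s, 0 <= s -> in_V (u s)) by apply (proj1 (proj2 Hu)).
assert (Hu0 : forall j, u 0 j = u0 j) by apply (proj1 Hu).
assert (Hv : forall j, 0 <= v j <= rho ^ j) by (intros j; now apply u_tilde_bounds).
assert (Hrpow : forall j, 0 < rho ^ j <= 1).
  intros j; split; [apply pow_lt; lra|rewrite <- (pow1 j); apply pow_incr; lra].
assert (Htpow : forall j, 0 < theta ^ j) by (intros j; apply pow_lt; lra).
assert (HINR : 1 <= INR L) by (apply (le_INR 1); easy).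
assert (Hc : 0 < c) by (apply Rdiv_lt_0_compat; lra).
assert (HC0 : 0 < C0).
  apply Rdiv_lt_0_compat; [lra|apply pow_lt; lra].
assert (HK : 0 < K) by (apply Rmult_lt_0_compat; [apply exp_pos|easy]).
(* [c * (1 - rho) = L] makes [h i / h (S i) = theta * exp (L * rho ^ S i)]. *)
set (h := fun i => exp (c * rho ^ S i) / theta ^ S i).
assert (Hh1 : forall i, / theta ^ S i <= h i).
  intros i; unfold h, Rdiv; rewrite <- (Rmult_1_l (/ _)) at 1.
  apply Rmult_le_compat_r; [now left; apply Rinv_0_lt_compat|].
  assert (H := exp_ineq1_le (c * rho ^ S i)).
  assert (0 <= c * rho ^ S i) by (apply Rmult_le_pos; [lra|apply Rlt_le, Hrpow]); lra.
assert (Hh2 : forall i, h i <= exp c * / theta ^ S i).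
  intros i; apply Rmult_le_compat_r; [now left; apply Rinv_0_lt_compat|].
  destruct (proj2 (Hrpow (S i))) as [Hlt|Heq].
    left; apply exp_increasing; nra.
  rewrite Heq, Rmult_1_r; apply Rle_refl.
assert (Hh0 : forall i, 0 <= h i).
  intros i; eapply Rle_trans; [|apply Hh1]; now left; apply Rinv_0_lt_compat.
(* Index [i] of [z] and [h] stands for site [S i], whereas [p s i] below is the flux from site [i]
   into site [S i]; [p s 0] vanishes because both sequences are 1 at site 0. *)
set (z := fun s i => Rabs (u (Rmax 0 s) (S i) - v (S i))).
assert (Hz0 : forall s i, 0 <= z s i) by (intros; apply Rabs_pos).
assert (Hhardy : forall s n, psum (fun i => h i * tail (z s) n i ^ 2) n <=
    K * psum (fun i => z s i ^ 2 / theta ^ S i) n).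
  intros s n.
  apply Rle_trans with (exp c * psum (fun i => tail (z s) n i ^ 2 / theta ^ S i) n).
    rewrite <- psum_scal; apply psum_le; intros i _.
    assert (H := Rmult_le_compat_r _ _ _ (pow2_ge_0 (tail (z s) n i)) (Hh2 i)).
    unfold Rdiv; lra.
  unfold K; rewrite Rmult_assoc; apply Rmult_le_compat_l; [left; apply exp_pos|].
  apply hardy_tail; [easy|apply tail_head|unfold tail; ring].
assert (Hweight : forall s n, psum (fun i => z s i ^ 2 / theta ^ S i) n <=
    psum (fun i => h i * z s i ^ 2) n).
  intros s n; apply psum_le; intros i _.
  assert (H := Rmult_le_compat_r _ _ _ (pow2_ge_0 (z s i)) (Hh1 i)).
  unfold Rdiv; lra.
assert (HzE : forall s n, psum (fun i => z s i ^ 2 / theta ^ S i) n <=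
    psum (fun i => h i * tail (z s) n i ^ 2) n).
  intros s n; eapply Rle_trans; [apply Hweight|].
  apply psum_le; intros i Hi; apply Rmult_le_compat_l; [easy|].
  apply pow_incr; split; [easy|].
  rewrite tail_head; assert (H := tail_nonneg (z s) n (S i) (Hz0 s) Hi); lra.
set (q := sqrt theta).
assert (Hq : 0 < q) by (apply sqrt_lt_R0; lra).
assert (Hqq : q * q = theta) by (apply sqrt_sqrt; lra).
set (w := damped_sum (fun j => u0 j / q ^ j)).
set (kappa := 2 * alpha / q + 1).
assert (Hkappa : 0 <= kappa)
  by (assert (0 < 2 * alpha / q) by (apply Rdiv_lt_0_compat; lra); unfold kappa; lra).
(* A bound on [z s n ^ 2 * psum h n] for all [s] in [[0, t]]. The square gains [theta ^ S n], which
   offsets the growth [theta ^ (-n)] of the summed weights; the two summands come from [u] and from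
   the stationary point. *)
set (B := fun n => exp c / (1 - theta) *
   (w (S n) ^ 2 * exp (kappa * t) ^ 2 + rho ^ S n)).
assert (HBlim : is_lim_seq B 0).
  assert (Hw : is_lim_seq (fun n => w (S n)) 0).
    apply is_lim_seq_incr_1 with (u := w), is_lim_damped_sum.
      intros j; rewrite <- Hu0; apply Rdiv_le_0_compat; [|now apply pow_lt].
      apply in_V_bounds, HVs; lra.
    apply is_lim_weighted_of_summable; [lra| |easy].
    intros j; rewrite <- Hu0; apply in_V_bounds, HVs; lra.
  assert (Hr : is_lim_seq (fun n => rho ^ S n) 0).
    apply is_lim_seq_incr_1 with (u := pow rho), is_lim_seq_geom.
    rewrite Rabs_pos_eq; lra.
  (* The limit is written in the shape to which the power [^ 2] unfolds. *)
  replace (Finite 0) with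
    (Finite (exp c / (1 - theta) * (0 * (0 * 1) * exp (kappa * t) ^ 2 + 0)))
    by (f_equal; ring).
  apply (is_lim_seq_scal_l _ _ (Finite _)).
  apply (is_lim_seq_plus' _ _ (0 * (0 * 1) * exp (kappa * t) ^ 2) 0); [|exact Hr].
  apply (is_lim_seq_scal_r _ _ (Finite _)).
  apply (is_lim_seq_mult' _ _ 0 (0 * 1)); [exact Hw|].
  apply (is_lim_seq_mult' _ _ 0 1); [exact Hw|apply is_lim_seq_const].
assert (HB : forall s n, 0 <= s <= t -> z s n ^ 2 * psum h n <= B n).
  intros s n Hs.
  assert (Hsum : psum h n <= exp c * / ((1 - theta) * theta ^ n)).
    apply Rle_trans with (exp c * psum (fun i => / theta ^ S i) n).
      rewrite <- psum_scal; apply psum_le; intros i _; apply Hh2.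
    apply Rmult_le_compat_l; [left; apply exp_pos|now apply psum_inv_pow_le].
  assert (Hg := V_solution_growth alpha beta L u0 u q s (S n) Hab HL Hq Hu (proj1 Hs)).
  fold w kappa in Hg.
  assert (Hb := in_V_bounds _ (S n) (HVs s (proj1 Hs))).
  assert (Hwpos : 0 <= q ^ S n * w (S n)).
    assert (H := exp_pos (kappa * s)).
    destruct (Rle_dec 0 (q ^ S n * w (S n))) as [|Hneg]; [easy|nra].
  assert (Hexp : exp (kappa * s) <= exp (kappa * t)).
    destruct (Rle_lt_or_eq_dec (kappa * s) (kappa * t)) as [Hlt|Heq].
      apply Rmult_le_compat_l; lra.
      now left; apply exp_increasing.
      rewrite Heq; apply Rle_refl.
  assert (Hg2 : u s (S n) ^ 2 <= theta ^ S n * (w (S n) ^ 2 * exp (kappa * t) ^ 2)).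
    apply Rle_trans with ((q ^ S n * w (S n) * exp (kappa * t)) ^ 2).
      apply pow_incr; split; [lra|].
      eapply Rle_trans; [exact Hg|now apply Rmult_le_compat_l].
    right; rewrite <- Hqq, (Rpow_mult_distr q q); ring.
  assert (Hv2 : v (S n) ^ 2 <= theta ^ S n * rho ^ S n).
    apply Rle_trans with (rho ^ S n * rho ^ S n).
      apply Rle_trans with ((rho ^ S n) ^ 2); [apply pow_incr, Hv|right; ring].
    apply Rmult_le_compat_r; [apply Rlt_le, Hrpow|apply pow_incr; lra].
  assert (Hz2 : z s n ^ 2 <=
     theta ^ S n * (w (S n) ^ 2 * exp (kappa * t) ^ 2 + rho ^ S n)).
    unfold z; rewrite <- Rsqr_pow2, <- Rsqr_abs, Rsqr_pow2, Rmax_right by lra.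
    assert (0 <= u s (S n) * v (S n)) by (apply Rmult_le_pos; [lra|apply Hv]).
    lra.
  apply Rle_trans with (theta ^ S n * (w (S n) ^ 2 * exp (kappa * t) ^ 2 + rho ^ S n)
     * (exp c * / ((1 - theta) * theta ^ n))).
    apply Rmult_le_compat; [apply pow2_ge_0|now apply psum_nonneg; auto|easy|easy].
  assert (Hpos : 0 <= B n).
    apply Rmult_le_pos; [apply Rdiv_le_0_compat; [left; apply exp_pos|lra]|].
    apply Rplus_le_le_0_compat; [|apply Rlt_le, Hrpow].
    apply Rmult_le_pos; apply pow2_ge_0.
  apply Rle_trans with (theta * B n); [right; unfold B; simpl; field|nra].
  specialize (Htpow n); lra.
set (p := fun s i => alpha * Rabs (u s i ^ L - v i ^ L)).
(* The factor [a] is at most [1 + L * rho ^ S i], hence at most [exp (L * rho ^ S i)], and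
   [alpha <= beta * theta]; together these match the ratio [h i / h (S i)]. *)
assert (Hflux : forall s i, 0 <= s -> h (S i) * p s (S i) <= beta * h i * z s i).
  intros s i Hs; unfold p, z; rewrite Rmax_right by easy.
  assert (Hv1 : 0 <= v (S i) <= 1) by (specialize (Hv (S i)); specialize (Hrpow (S i)); lra).
  destruct (pow_minus_factor L _ _ HL (in_V_bounds _ (S i) (HVs s Hs)) Hv1)
    as [a [Ha Heq]].
  rewrite Heq, Rabs_mult, (Rabs_pos_eq a), <- !Rmult_assoc by lra.
  apply Rmult_le_compat_r; [apply Rabs_pos|].
  assert (Hae : a <= exp (INR L * rho ^ S i)).
    assert (H := exp_ineq1_le (INR L * rho ^ S i)).
    assert (INR L * v (S i) <= INR L * rho ^ S i)
      by (apply Rmult_le_compat_l; [lra|apply Hv]).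
    lra.
  assert (Hexp : exp (c * rho ^ S i) = exp (c * rho ^ S (S i)) * exp (INR L * rho ^ S i)).
    rewrite <- exp_plus; f_equal; unfold c; simpl; field; lra.
  assert (Hat : alpha <= beta * theta).
    replace alpha with (beta * rho) by (unfold rho; field; lra).
    apply Rmult_le_compat_l; lra.
  unfold h; rewrite Hexp.
  assert (He := exp_pos (c * rho ^ S (S i))).
  specialize (Htpow (S i)).
  change (theta ^ S (S i)) with (theta * theta ^ S i).
  apply Rle_trans with (exp (c * rho ^ S (S i)) / (theta * theta ^ S i) * (alpha * a)); [lra|].
  apply Rle_trans with (exp (c * rho ^ S (S i)) / (theta * theta ^ S i) *
     (beta * theta * exp (INR L * rho ^ S i))).
    apply Rmult_le_compat_l.
      apply Rdiv_le_0_compat; [lra|apply Rmult_lt_0_compat; lra].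
    apply Rmult_le_compat; lra.
  right; field; lra.
assert (HE : forall n, psum (fun i => h i * tail (z t) n i ^ 2) n <=
   exp (- (beta / K) * t) * psum (fun i => h i * tail (z 0) n i ^ 2) n
   + beta * K * B n / (beta / K)).
  intros n.
  apply (dini_gronwall (fun s => psum (fun i => h i * tail (z s) n i ^ 2) n)).
  - easy.
  - apply Rdiv_lt_0_compat; lra.
  - intros s; apply (continuous_psum (fun s i => h i * tail (z s) n i ^ 2)).
    assert (Hzc : forall i, continuous (fun s => z s i) s).
      intros i; apply continuous_comp; [|apply continuous_Rabs].
      apply (continuous_minus (V := R_NormedModule)); [|apply continuous_const].
      eapply V_solution_continuous; exact Hu.
    intros i.
    assert (Hc' : continuous (fun s => tail (z s) n i) s).
      apply (continuous_minus (V := R_NormedModule)); now apply continuous_psum.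
    apply (continuous_mult (K := R_AbsRing)); [apply continuous_const|].
    apply (continuous_mult (K := R_AbsRing)); [exact Hc'|].
    apply (continuous_mult (K := R_AbsRing)); [exact Hc'|apply continuous_const].
  - intros s Hs.
    apply dini_le_weaken with (- (beta / K) * psum (fun i => h i * tail (z s) n i ^ 2) n
      + beta * K * z s n ^ 2 * psum h n).
      apply Rplus_le_compat_l; rewrite (Rmult_assoc (beta * K)).
      apply Rmult_le_compat_l; [apply Rmult_le_pos; lra|apply HB; lra].
    apply (dini_energy z (p s)); try easy; try lra.
    + intros i; apply Rmult_le_pos; [lra|apply Rabs_pos].
    + unfold p; rewrite (proj1 (HVs s ltac:(lra))); unfold v; rewrite u_tilde_0.
      rewrite Rminus_diag, Rabs_R0; ring.
    + intros i; apply Hflux; lra.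
    + intros i; unfold z at 2 3; rewrite (Rmax_right 0 s) by lra.
      eapply dini_le_weaken; [|eapply (dini_abs_difference alpha beta L u0 u s i); easy].
      apply Rle_refl.
    + eapply Rle_trans; [apply Hhardy|].
      apply Rmult_le_compat_l; [lra|apply Hweight].
  - apply Rmult_le_pos; [apply Rmult_le_pos; lra|].
    eapply Rle_trans; [|apply (HB 0); lra].
    apply Rmult_le_pos; [apply pow2_ge_0|now apply psum_nonneg].
assert (Hsq : forall s i, 0 <= s -> z s i ^ 2 = (u s (S i) - v (S i)) ^ 2).
  intros s i Hs; unfold z; rewrite Rmax_right by easy.
  now rewrite <- Rsqr_pow2, <- Rsqr_abs, Rsqr_pow2.
assert (Hinit : forall n, psum (fun i => z 0 i ^ 2 / theta ^ S i) n <= S0).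
  intros n.
  apply Rle_trans with (psum (fun i => (u0 (S i) - v (S i)) ^ 2 / g theta (S i)) n).
    apply psum_le; intros i _; rewrite Hsq, Hu0 by lra; apply Rle_refl.
  apply psum_le_Series; [|exact Hdiff].
  intros i; apply Rdiv_le_0_compat; [apply pow2_ge_0|apply Htpow].
(* The truncation rank [n] tends to infinity with [m] fixed, which removes the boundary term. *)
apply (is_lim_seq_le_loc (fun _ => psum (fun i => (u t (S i) - v (S i)) ^ 2 / g theta (S i)) m)
  (fun n => exp (- (beta / K) * t) * K * S0 + beta * K / (beta / K) * B n)
  (psum (fun i => (u t (S i) - v (S i)) ^ 2 / g theta (S i)) m)
  (exp (- (beta / K) * t) * K * S0)).
- exists m; intros n Hmn.
  apply Rle_trans with (psum (fun i => z t i ^ 2 / theta ^ S i) n).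
    eapply Rle_trans; [|apply psum_le_mono; [|exact Hmn]].
      apply psum_le; intros i _; rewrite Hsq by easy; apply Rle_refl.
    intros i; apply Rdiv_le_0_compat; [apply pow2_ge_0|apply Htpow].
  eapply Rle_trans; [apply HzE|].
  eapply Rle_trans; [apply HE|].
  apply Rplus_le_compat; [|right; unfold Rdiv; ring].
  rewrite Rmult_assoc; apply Rmult_le_compat_l; [left; apply exp_pos|].
  eapply Rle_trans; [apply Hhardy|].
  apply Rmult_le_compat_l; [lra|apply Hinit].
- apply is_lim_seq_const.
- replace (Finite (exp (- (beta / K) * t) * K * S0)) with
    (Finite (exp (- (beta / K) * t) * K * S0 + beta * K / (beta / K) * 0))
    by (f_equal; ring).
  apply is_lim_seq_plus'; [apply is_lim_seq_const|].
  exact (is_lim_seq_scal_l B (beta * K / (beta / K)) 0 HBlim).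
Qed.

(** * Summability of the differences and conclusion *)

Lemma L2_summable_minus (w x y : nat -> R) :
  (forall k, 0 < w k) -> L2_summable w x -> L2_summable w y ->
  L2_summable w (fun k => x k - y k).
Proof.
intros Hw Hx Hy.
apply (ex_series_le (K := R_AbsRing) (V := R_CompleteNormedModule) _
  (fun k => 2 * (x (S k) ^ 2 / w (S k)) + 2 * (y (S k) ^ 2 / w (S k)))).
- intros k; specialize (Hw (S k)); unfold norm; simpl norm; unfold abs; simpl abs.
  rewrite Rabs_pos_eq by (apply Rdiv_le_0_compat; [apply pow2_ge_0|easy]).
  replace (2 * (x (S k) ^ 2 / w (S k)) + 2 * (y (S k) ^ 2 / w (S k)))
    with ((2 * x (S k) ^ 2 + 2 * y (S k) ^ 2) / w (S k)) by (field; lra).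
  apply Rmult_le_compat_r; [now left; apply Rinv_0_lt_compat|].
  assert (H := pow2_ge_0 (x (S k) + y (S k))); simpl in *; lra.
- apply (ex_series_plus (K := R_AbsRing) (V := R_NormedModule));
    now apply (ex_series_scal (K := R_AbsRing) (V := R_NormedModule)).
Qed.

(** One factor of [rho ^ S k * rho ^ S k] is absorbed by the weight, as [rho <= theta], and the
    other is summable; so [theta = rho] is allowed. *)
Lemma L2_summable_u_tilde (rho theta : R) (L : nat) :
  (1 <= L)%nat -> 0 < rho < 1 -> rho <= theta -> L2_summable (g theta) (u_tilde rho L).
Proof.
intros HL Hrho Hth.
apply (ex_series_le (K := R_AbsRing) (V := R_CompleteNormedModule) _
  (fun k => rho ^ S k)).
- intros k; unfold norm; simpl norm; unfold abs; simpl abs.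
  assert (Htp : 0 < theta ^ S k) by (apply pow_lt; lra).
  assert (Hrp : 0 < rho ^ S k) by (apply pow_lt; lra).
  unfold g; rewrite Rabs_pos_eq by (apply Rdiv_le_0_compat; [apply pow2_ge_0|easy]).
  apply Rle_div_l; [easy|].
  apply Rle_trans with ((rho ^ S k) ^ 2); [now apply pow_incr, u_tilde_bounds|].
  replace ((rho ^ S k) ^ 2) with (rho ^ S k * rho ^ S k) by ring.
  apply Rmult_le_compat_l; [lra|apply pow_incr; lra].
- apply (ex_series_incr_1 (pow rho)), ex_series_geom; rewrite Rabs_pos_eq; lra.
Qed.

Theorem theorem2p12 (alpha beta : R) (L : nat) (theta : R)
    (h_alpha : 0 < alpha) (h_beta : alpha < beta) (h_L : (1 <= L)%nat)
    (h_theta_ge : alpha / beta <= theta) (h_theta_lt : theta < 1) :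
  exists gamma C : R, 0 < gamma /\
    forall u0 : nat -> R, in_V u0 -> L2_summable (g theta) u0 ->
    forall u : R -> nat -> R, is_V_solution alpha beta L u0 u ->
    forall t : R, 0 <= t ->
      in_L2 (g theta) (fun k => u t k - u_tilde (alpha / beta) L k) /\
      L2_norm (g theta) (fun k => u t k - u_tilde (alpha / beta) L k) <=
        exp (- gamma * t) * C *
        L2_norm (g theta) (fun k => u0 k - u_tilde (alpha / beta) L k).
Proof.
assert (Hrho : 0 < alpha / beta < 1).
  split; [apply Rdiv_lt_0_compat; lra|apply Rlt_div_l; lra].
set (K := exp (INR L / (1 - alpha / beta)) * (2 * (1 + theta) / (1 - theta) ^ 2)).
assert (HK : 0 < K).
  apply Rmult_lt_0_compat; [apply exp_pos|].
  apply Rdiv_lt_0_compat; [|apply pow_lt]; lra.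
assert (Hg : forall k, 0 < g theta k) by (intros k; apply pow_lt; lra).
(* The energy estimate concerns squared norms, so taking roots halves the rate and replaces [K] by
   [sqrt K]. *)
exists (beta / K / 2), (sqrt K); split.
  apply Rdiv_lt_0_compat; [apply Rdiv_lt_0_compat|]; lra.
intros u0 HV0 Hs0 u Hu t Ht.
assert (Hdiff : L2_summable (g theta) (fun k => u0 k - u_tilde (alpha / beta) L k)).
  apply L2_summable_minus; [easy|easy|now apply L2_summable_u_tilde].
assert (Hterm : forall i, 0 <=
   (u t (S i) - u_tilde (alpha / beta) L (S i)) ^ 2 / g theta (S i)).
  intros i; apply Rdiv_le_0_compat; [apply pow2_ge_0|apply Hg].
(* The bound on all partial sums also yields summability at time [t], so that [Series] is not a
   default value. *)
destruct (Series_le_bound _ _ Hterm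
  (V_solution_energy_decay alpha beta L theta u0 u t (conj h_alpha h_beta) h_L
    (conj h_theta_ge h_theta_lt) Hs0 Hu Ht Hdiff)) as [Hex Hle].
fold K in Hle.
split; [split; [|exact Hex]|].
  rewrite (proj1 (proj1 (proj2 Hu) t Ht)), u_tilde_0; ring.
unfold L2_norm.
eapply Rle_trans; [apply sqrt_le_1_alt; exact Hle|].
rewrite !sqrt_mult_alt; [| |apply Rmult_le_pos; [left; apply exp_pos|lra]].
  apply Rmult_le_compat_r; [apply sqrt_pos|].
  apply Rmult_le_compat_r; [apply sqrt_pos|].
  right; rewrite <- (sqrt_pow2 (exp (- (beta / K / 2) * t))) by (left; apply exp_pos).
  f_equal; simpl; rewrite Rmult_1_r, <- exp_plus; f_equal; field; lra.
left; apply exp_pos.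
Qed.
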